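(* Let $N$ be a normal subgroup of a finite group $G$, and let $\Delta=\{\chi_1=1_G,\chi_2,\dots,\chi_k\}$ be a representative system of the equivalence classes of the equivalence relation with respect to $N$ on $\mathrm{Irr}(G)$. For each $i$ let $\theta_i\in\mathrm{Irr}(N)$ be an irreducible constituent of $(\chi_i)_N$, $t_i=|G:I_G(\theta_i)|$, $e_i=[(\chi_i)_N,\theta_i]$ and $\lambda_i=|N|\,t_i\,e_i^2$. Let $\chi\in\mathrm{Irr}(G)$ and $i\in\{1,\dots,k\}$ be such that $\chi=\chi_i\in\Delta$. Then $\chi_N\in\mathrm{Irr}(N)$ if and only if $\lambda_i=|N|$.
   Context: Characters are over $\mathbb{C}$; $\chi_N$ is the restriction of $\chi$ to $N$. $G$ acts on $\mathrm{Irr}(N)$ by $\theta^g(x)=\theta(gxg^{-1})$, and $I_G(\theta)=\{g\in G\mid\theta^g=\theta\}$. Two characters $\chi,\phi\in\mathrm{Irr}(G)$ are equivalent with respect to $N$ if $[\chi_N,\phi_N]\ne0$; this is an equivalence relation. The number $k$ of its classes equals the number of conjugacy classes of $G$ contained in $N$. The number $\lambda_i$ is the $i$-th diagonal entry of the diagonal matrix $\Lambda_{\mathsf{X}}=\mathrm{diag}(\lambda_1,\dots,\lambda_k)$ associated to the $G$-character table $\mathsf{X}=(\chi_i(n_j))_{1\le i,j\le k}$ of $N$, where $n_1^G,\dots,n_k^G$ are the conjugacy classes of $G$ contained in $N$. *)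

(* Defs.v *)
From HB Require Import structures.
From mathcomp Require Import all_boot all_order all_algebra all_fingroup.
From mathcomp Require Import all_solvable all_field all_character.

Set Implicit Arguments.
Unset Strict Implicit.
Unset Printing Implicit Defensive.

Import Order.TTheory GRing.Theory Num.Theory GroupScope.
Local Open Scope ring_scope.

(* Characters take values in algC, which contains all values of complex       *)
(* characters of finite groups; irreducible characters are indexed by Iirr G. *)

Definition res_equiv (gT : finGroupType) (G N : {group gT}) : rel (Iirr G) :=
  fun i j => '['Res[N] 'chi_i, 'Res[N] 'chi_j] != 0.

(* Exactly one index i for each j: this makes Delta injective as well, since  *)
(* res_equiv is reflexive.                                                    *)
Definition is_rep_system (gT : finGroupType) (G N : {group gT}) (k : nat)
    (Delta : 'I_k -> Iirr G) : Prop :=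
  forall j : Iirr G, exists! i : 'I_k, res_equiv N (Delta i) j.

(* Main.v *)
(* By Clifford's theorem, Res chi_i is e_i times the sum of the t_i distinct
   conjugates of theta_i, so [Res chi_i, Res chi_i] = t_i e_i^2 and
   lambda_i = |N| [Res chi_i, Res chi_i].  A character is irreducible exactly
   when its norm is 1. *)
Require Import Defs.
From HB Require Import structures.
From mathcomp Require Import all_boot all_order all_algebra all_fingroup.
From mathcomp Require Import all_solvable all_field all_character.

Set Implicit Arguments.
Unset Strict Implicit.
Unset Printing Implicit Defensive.

Import Order.TTheory GRing.Theory Num.Theory GroupScope.
Local Open Scope ring_scope.

(** Clifford's decomposition is substituted in one argument of the inner product only, so
    orthogonality of the conjugates is never invoked. *)
Lemma cfnorm_Res_irr (gT : finGroupType) (G N : {group gT})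
    (i : Iirr G) (j : Iirr N) :
    N <| G -> j \in irr_constt ('Res[N] 'chi_i) ->
  '['Res[N] 'chi_i]
    = #|G : 'I_G['chi_j]|%:R * '['Res[N] 'chi_i, 'chi_j] ^+ 2.
Proof.
move=> nsNG iNj; set e := '[_, 'chi_j].
have e_nat : e \in Num.nat by rewrite Cnat_cfdot_char ?cfRes_char ?irr_char.
rewrite {2}(Clifford_Res_sum_cfclass nsNG iNj) -/e cfdotZr cfdot_sumr.
(* A restriction from [G] is invariant under conjugation by [G], so it pairs equally with all
   conjugates of ['chi_j]. *)
have conj_e xi : xi \in ('chi_j ^: G)%CF -> '['Res[N] 'chi_i, xi] = e.
  by case/cfclassP=> y Gy ->; rewrite cfdot_Res_conjg.
rewrite (eq_big_seq (fun _ => e) conj_e) big_const_seq count_predT iter_addr_0.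
(* The scalar [e] left the second argument conjugated; being a natural number, it is its own
   conjugate. *)
by rewrite size_cfclass conj_natr // mulrnAr -expr2 mulr_natl.
Qed.

Theorem corollary4p9 (gT : finGroupType) (G N : {group gT}) (nsNG : N <| G)
    (k : nat) (Delta : 'I_k -> Iirr G)
    (Delta_rep : is_rep_system N Delta)
    (Delta_1 : forall i : 'I_k, i = 0%N :> nat -> 'chi_(Delta i) = 1)
    (theta : 'I_k -> Iirr N)
    (theta_constt : forall i, theta i \in irr_constt ('Res[N] 'chi_(Delta i)))
    (t : 'I_k -> nat) (e lambda : 'I_k -> algC)
    (t_def : forall i, t i = #|G : 'I_G['chi_(theta i)]|)
    (e_def : forall i, e i = '['Res[N] 'chi_(Delta i), 'chi_(theta i)])
    (lambda_def : forall i, lambda i = #|N|%:R * (t i)%:R * e i ^+ 2)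
    (chi : 'CF(G)) (chi_irr : chi \in irr G)
    (i : 'I_k) (chi_i : chi = 'chi_(Delta i)) :
  'Res[N] chi \in irr N <-> lambda i = #|N|%:R.
Proof.
have N_neq0 : #|N|%:R != 0 :> algC by rewrite pnatr_eq0 -lt0n cardG_gt0.
rewrite lambda_def t_def e_def -mulrA chi_i.
(* Since the restriction is a character, only the norm-one condition remains on the left. *)
rewrite -(cfnorm_Res_irr nsNG (theta_constt i)) irrEchar cfRes_char ?irr_char //=.
split=> [/eqP -> | /eqP]; first by rewrite mulr1.
by rewrite -[X in _ == X]mulr1 (inj_eq (mulfI N_neq0)).
Qed.
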